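(* Let $\mathbb I=[0,1]$, let $\mathcal C_0$ be the family of all minimal Cantor sets in the Hilbert cube $\mathbb I^\omega$, and let $\sigma\mathcal C_0$ be the $\sigma$-ideal generated by $\mathcal C_0$. If $\mathcal I$ is a non-trivial topologically invariant ideal with analytic base on $\mathbb I^\omega$, then $\mathcal C_0\subseteq\mathcal I$. If $\mathcal I$ is a non-trivial topologically invariant $\sigma$-ideal with analytic base on $\mathbb I^\omega$, then $\sigma\mathcal C_0\subseteq\mathcal I$.
   Context: An ideal on a set $X$ is a non-empty family of subsets of $X$ closed under subsets and finite unions; it is a $\sigma$-ideal if it is closed under countable unions. An ideal $\mathcal I$ on $X$ is non-trivial if it contains some uncountable subset of $X$ and $\mathcal I\ne\mathcal P(X)$. An ideal $\mathcal I$ on a topological space $X$ is topologically invariant if $\mathcal I=\{h(A):A\in\mathcal I\}$ for every homeomorphism $h:X\to X$. An ideal $\mathcal I$ on a Polish space $X$ has analytic base if each $A\in\mathcal I$ is contained in some analytic set $B\in\mathcal I$ (analytic: continuous image of a Polish space). The $\sigma$-ideal $\sigma\mathcal F$ generated by a family $\mathcal F$ consists of all subsets of countable unions of sets from $\mathcal F$. A Cantor set in $\mathbb I^\omega$ is a subset homeomorphic to $\{0,1\}^\omega$. A Cantor set $A\subseteq\mathbb I^\omega$ is minimal if for each Cantor set $B\subseteq\mathbb I^\omega$ there is a homeomorphism $h:\mathbb I^\omega\to\mathbb I^\omega$ with $h(A)\subseteq B$. *)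

(* Defs.v *)
From HB Require Import structures.
From mathcomp Require Import all_boot all_order all_algebra.
From mathcomp Require Import all_classical reals topology cantor.

Set Implicit Arguments.
Unset Strict Implicit.
Unset Printing Implicit Defensive.

Import Order.TTheory GRing.Theory Num.Theory.
Import numFieldTopology.Exports.

Local Open Scope classical_set_scope.
Local Open Scope ring_scope.

(* [0, 1] is coerced to [set_type], which carries the topology induced by R. *)
Definition hilbert_cube (R : realType) : Type :=
  prod_topology (fun _ : nat => (`[0, 1]%classic : set R) : Type).

HB.instance Definition _ (R : realType) :=
  Topological.copy (hilbert_cube R)
    (prod_topology (fun _ : nat => (`[0, 1]%classic : set R) : Type)).

Definition homeomorphism (X Y : topologicalType) (h : X -> Y) : Prop :=
  continuous h /\
  exists g : Y -> X, [/\ continuous g, cancel h g & cancel g h].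

Definition homeomorphic (X Y : topologicalType) : Prop :=
  exists h : X -> Y, homeomorphism h.

Definition separable (X : topologicalType) : Prop :=
  exists2 D : set X, countable D & dense D.

(* The library's completeness of uniform spaces, as a predicate; on a metric
   space it amounts to the convergence of Cauchy sequences. *)
Definition complete_space (X : uniformType) : Prop :=
  forall F : set_system X, ProperFilter F -> cauchy F -> exists x : X, F --> x.

Definition completely_metrizable (R : realType) (X : topologicalType) : Prop :=
  exists2 M : metricType R, complete_space M & homeomorphic X M.

Definition polish (R : realType) (X : topologicalType) : Prop :=
  separable X /\ completely_metrizable R X.

(* [P] may be empty, so the empty set is analytic. *)
Definition analytic (R : realType) (X : topologicalType) (A : set X) : Prop :=
  exists2 P : topologicalType, polish R P &
    exists2 f : P -> X, continuous f & A = range f.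

Definition ideal (X : Type) (I : set_system X) : Prop :=
  [/\ I !=set0,
      forall A B : set X, A `<=` B -> I B -> I A &
      forall A B : set X, I A -> I B -> I (A `|` B)].

Definition sigma_ideal (X : Type) (I : set_system X) : Prop :=
  ideal I /\
  forall C : set_system X, countable C -> C `<=` I ->
    I (\bigcup_(A in C) A).

Definition nontrivial_ideal (X : Type) (I : set_system X) : Prop :=
  (exists2 A : set X, I A & ~ countable A) /\ I <> [set: set X].

Definition topologically_invariant (X : topologicalType) (I : set_system X)
    : Prop :=
  forall h : X -> X, homeomorphism h -> I = [set h @` A | A in I].

Definition has_analytic_base (R : realType) (X : topologicalType)
    (I : set_system X) : Prop :=
  forall A : set X, I A -> exists B : set X, [/\ I B, analytic R B & A `<=` B].

(* A countable subfamily rather than a sequence, so that the empty family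
   generates the ideal containing only the empty set. *)
Definition sigma_generated (X : Type) (F : set_system X) : set_system X :=
  [set A | exists C : set_system X,
     [/\ countable C, C `<=` F & A `<=` \bigcup_(B in C) B]].

Definition cantor_set (X : topologicalType) (A : set X) : Prop :=
  homeomorphic (set_type A) cantor_space.

Definition minimal_cantor_set (X : topologicalType) (A : set X) : Prop :=
  cantor_set A /\
  forall B : set X, cantor_set B ->
    exists2 h : X -> X, homeomorphism h & h @` A `<=` B.

Definition minimal_cantor_sets (X : topologicalType) : set_system X :=
  [set A | minimal_cantor_set A].
Arguments minimal_cantor_sets : clear implicits.

(* Main.v *)
(** The perfect set property of analytic sets does the work: an uncountable
    analytic set contains a Cantor set.  Indeed, if [f] maps a complete separable
    metric space [M] continuously onto an uncountable set, then deleting the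
    points of [M] having a neighbourhood with countable image only removes a
    countable set from the image; near any remaining point there are two
    remaining points with distinct images, so one can grow a binary tree of
    shrinking closed discs in which siblings have disjoint images.  Its branches
    form a Cantor space on which [f] is injective.

    A non-trivial ideal with analytic base thus has a Cantor set among its
    elements.  A minimal Cantor set is carried into it by a homeomorphism, and so
    belongs to the ideal by invariance. *)
Require Import Defs.
From mathcomp Require Import all_boot all_order all_algebra.
From mathcomp Require Import all_classical reals topology.
From mathcomp Require Import cantor.

Set Implicit Arguments.
Unset Strict Implicit.
Unset Printing Implicit Defensive.

Import Order.TTheory GRing.Theory Num.Theory.
Import numFieldTopology.Exports.

Local Open Scope classical_set_scope.
Local Open Scope ring_scope.

(** * Hausdorff spaces and the recognition of Cantor sets *)

Lemma injective_hausdorff (X Y : topologicalType) (f : X -> Y) :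
  continuous f -> injective f -> hausdorff_space Y -> hausdorff_space X.
Proof.
move=> cf injf hY p q pq; apply/injf/hY => A B fpA fqB.
by have [z [Az Bz]] := pq _ _ (cf p _ fpA) (cf q _ fqB); exists (f z).
Qed.

Lemma hilbert_cube_hausdorff (R : realType) : hausdorff_space (hilbert_cube R).
Proof.
have := @hausdorff_product nat (fun=> set_type (`[0, 1]%classic : set R)).
apply => _.
apply: (@injective_hausdorff _ R set_val); last exact: Rhausdorff.
  exact: initial_continuous.
exact: val_inj.
Qed.

(** A continuous bijection from a compact space onto a Hausdorff space is closed, so its inverse is
    continuous. *)
Lemma cantor_set_range (X : topologicalType) (k : cantor_space -> X) :
  hausdorff_space X -> continuous k -> injective k -> cantor_set (range k).
Proof.
move=> hX ck injk.
have kin b : k b \in range k by apply: mem_set; exists b.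
pose g (b : cantor_space) : set_type (range k) := SigSub (kin b).
have cg : continuous g by apply: continuous_comp_initial; exact: ck.
have /choice[h hE] (x : set_type (range k)) : exists b, k b = val x.
  by have [b _ <-] := set_mem (valP x); exists b.
have gK : cancel g h by move=> b; apply: injk; rewrite hE.
have hK : cancel h g by move=> x; apply: val_inj; rewrite /= hE.
exists h; split; last by exists g.
apply/continuous_closedP => A clA.
have -> : h @^-1` A = g @` A.
  by apply/seteqP; split=> [x Ahx|_ [b Ab <-]] /=; [exists (h x)|rewrite gK].
apply: compact_closed.
  apply: (@injective_hausdorff _ X set_val _ _ hX).
    exact: initial_continuous.
  exact: val_inj.
apply: continuous_compact; first exact: continuous_subspaceT.
exact: subclosed_compact clA cantor_space_compact _.
Qed.

(** * Condensation points of a map and the splitting of discs *)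

Lemma exists_invSn_lt (R : realType) (e : R) : 0 < e ->
  exists n : nat, n.+1%:R^-1 < e.
Proof.
by move=> e0; have [n] := ltr_add_invr e0; rewrite add0r; exists n.
Qed.

(** A node of the tree is a pair of centre and radius. The discs are closed so that limits of later
    centres stay inside them. *)
Definition disc (R : realType) (M : metricType R) (p : M * R) : set M :=
  [set z | mdist p.1 z <= p.2].

Definition condensation_point (S T : topologicalType) (f : S -> T) : set S :=
  [set x | forall U, nbhs x U -> ~ countable (f @` U)].

(** Every other point lies in a ball with countable image whose centre is in the countable dense set
    and whose radius is some [n.+1%:R^-1]; there are only countably many such balls. *)
Lemma countable_image_noncondensation (R : realType) (M : metricType R)
    (X : topologicalType) (f : M -> X) :
  separable M -> countable (f @` ~` condensation_point f).
Proof.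
move=> [D cD dD].
pose B (p : M * nat) : set M := ball p.1 p.2.+1%:R^-1.
pose J := [set p : M * nat | D p.1 /\ countable (f @` B p)].
have cJ : countable J.
  apply: (@sub_countable _ _ _ (D `*` setT)); last exact: countableX.
  by apply: subset_card_le => p [Dp _].
apply: (@sub_countable _ _ _ (\bigcup_(p in J) (f @` B p))); last first.
  by apply: bigcup_countable => // p [].
apply: subset_card_le => _ [x /existsNP[U /not_implyP[xU /contrapT cU]] <-].
have [e /= e0 xeU] := (nbhs_ballP _ _).1 xU.
(* Half of [e], because a ball around [d] that contains [x] lies in the ball of twice its radius
   around [x]. *)
have [n ne] : exists n : nat, n.+1%:R^-1 < e / 2.
  by apply: exists_invSn_lt; rewrite divr_gt0.
have n0 : 0 < n.+1%:R^-1 :> R by rewrite invr_gt0.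
have [d [+ Dd]] : (ball x n.+1%:R^-1)° `&` D !=set0.
  apply: dD; last exact: open_interior.
  by exists x; exact: nbhsx_ballx.
move=> /interior_subset xd.
have Bx : B (d, n) x by exact: ball_sym.
exists (d, n); last by exists x.
split=> //; apply: sub_countable cU; apply: subset_card_le.
apply: image_subset => z dz; apply: xeU.
apply: (@le_ball _ _ _ (n.+1%:R^-1 + n.+1%:R^-1)); last exact: ball_triangle dz.
by rewrite [e]splitr ltW// ltrD.
Qed.

Lemma condensation_point_split (R : realType) (M : metricType R)
    (X : topologicalType) (f : M -> X) (p : M * R) :
  hausdorff_space X -> separable M -> continuous f ->
  condensation_point f p.1 -> 0 < p.2 ->
  exists q : bool -> M * R,
    (forall b, [/\ condensation_point f (q b).1, 0 < (q b).2,
                   (q b).2 <= p.2 / 2 & disc (q b) `<=` disc p]) /\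
    (forall u v, disc (q true) u -> disc (q false) v -> f u <> f v).
Proof.
case: p => x r /= hX sM cf cx r0.
have [y1 [y2 [[xy1 c1] [xy2 c2] ne]]] : exists y1 y2,
    [/\ (ball x r `&` condensation_point f) y1,
        (ball x r `&` condensation_point f) y2 & f y1 != f y2].
  (* Otherwise [f] takes at most one value on the condensation points in the ball and countably many
     on the rest, so the ball has countable image. *)
  apply: contrapT => noy; apply: (cx _ (nbhsx_ballx x r r0)).
  have -> : ball x r = (ball x r `&` condensation_point f) `|`
                       (ball x r `&` ~` condensation_point f).
    by rewrite -setIUr setUv setIT.
  rewrite image_setU -bigcup2E; apply: bigcup_countable => // -[|[|i]] _ /=.
  - have [->|/set0P[y Gy]] :=
      eqVneq (ball x r `&` condensation_point f) set0.
      by rewrite image_set0; exact: countable0.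
    apply: sub_countable (countable1 (f y)); apply: subset_card_le.
    move=> _ [z Gz <-] /=; apply: contrapT => /eqP zy.
    by apply: noy; exists z, y.
  - apply: sub_countable (countable_image_noncondensation f sM).
    by apply: subset_card_le; apply: image_subset => ? [].
  - exact: countable0.
move: hX; rewrite open_hausdorff => /(_ _ _ ne)[[A B] /=].
move=> [/set_mem Ay1 /set_mem By2] [oA oB /eqP AB].
have shrink y (U : set X) : open U -> U (f y) -> ball x r y -> exists s : R,
    [/\ 0 < s, s <= r / 2, disc (y, s) `<=` disc (x, r) &
        forall z, disc (y, s) z -> U (f z)].
  move=> oU Uy; rewrite ballEmdist/= => xy.
  have /cf/(nbhs_ballP _ _)[e /= e0 yeU] : nbhs (f y) U.
    by apply: open_nbhs_nbhs; split.
  (* The three bounds give, in order, halving of the radius, a closed disc inside the open ball of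
     radius [e], and nesting in the old disc by the triangle inequality. *)
  exists (Num.min (r / 2) (Num.min (e / 2) (r - mdist x y))); split.
  - by rewrite !lt_min subr_gt0 xy !divr_gt0.
  - by rewrite ge_min lexx.
  - move=> z; rewrite /disc /= !le_min => /and3P[_ _ yz].
    by rewrite (le_trans (metric_triangle x y z))// -lerBrDl.
  - move=> z; rewrite /disc /= !le_min => /and3P[_ yz _]; apply: yeU.
    by rewrite ballEmdist/= (le_lt_trans yz)// ltr_pdivrMr// ltr_pMr// ltr1n.
have [s1 [s10 s1r s1x s1A]] := shrink _ _ oA Ay1 xy1.
have [s2 [s20 s2r s2x s2B]] := shrink _ _ oB By2 xy2.
exists (fun b => if b then (y1, s1) else (y2, s2)); split; first by case.
move=> u v /s1A Au /s2B Bv fuv.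
by have : (A `&` B) (f u) by [split=> //; rewrite fuv]; rewrite AB.
Qed.

(** * Cantor schemes and their limit maps *)

Lemma cantor_agree_nbhs (b : cantor_space) (n : nat) :
  nbhs b [set c : cantor_space | forall i, (i < n)%N -> b i = c i].
Proof.
elim: n => [|n IH]; first by apply: filterS filterT.
have bn : nbhs b [set c : cantor_space | c n = b n].
  exact: (@proj_continuous nat (fun=> bool) n b _ (discrete_set1 (b n))).
apply: filterS (filterI IH bn) => c [bc cn] i.
by rewrite ltnS leq_eqVlt => /predU1P[->|/bc].
Qed.

(** The centres along a branch are Cauchy, and [g] sends the branch to their limit. Branches that
    agree below [n] share their [n]-th disc, which contains both limits; hence continuity. *)
Lemma cantor_scheme_limit (R : realType) (M : metricType R)
    (N : cantor_space -> nat -> M * R) :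
  complete_space M ->
  (forall b n, 0 < (N b n).2 <= n.+1%:R^-1) ->
  (forall b n, disc (N b n.+1) `<=` disc (N b n)) ->
  (forall (b c : cantor_space) n,
    (forall i, (i < n)%N -> b i = c i) -> N b n = N c n) ->
  exists2 g : cantor_space -> M, continuous g & forall b n, disc (N b n) (g b).
Proof.
move=> cM rN subN locN.
have le_disc b n m : (n <= m)%N -> disc (N b m) `<=` disc (N b n).
  elim: m => [|m IH]; first by rewrite leqn0 => /eqP ->.
  rewrite leq_eqVlt => /predU1P[->//|/IH]; apply: subset_trans; exact: subN.
have center b n m : (n <= m)%N -> disc (N b n) (N b m).1.
  move=> /le_disc; apply; rewrite /disc /= mdistxx.
  by have /andP[/ltW] := rN b m.
have small (e : R) : 0 < e -> exists n, forall b, (N b n).2 < e.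
  move=> /exists_invSn_lt[n ne]; exists n => b.
  by have /andP[_ /le_lt_trans] := rN b n; apply.
have limN (b : cantor_space) : exists x : M, (N b n).1 @[n --> \oo] --> x.
  apply: cM; apply: cauchy_exP => e e0.
  have [n ne] := small _ e0; exists (N b n).1.
  exists n => // m /= nm; rewrite ballEmdist /=.
  exact: le_lt_trans (center _ _ _ nm) (ne b).
have [g gN] := choice limN.
have gdisc b n : disc (N b n) (g b).
  rewrite /disc /=; apply/ler_addgt0Pr => e e0.
  have /cvg_ballP/(_ _ e0)[m _ me] := gN b.
  (* The centre of index [maxn m n] is both [e]-close to the limit and inside the [n]-th disc. *)
  have := me _ (leq_maxl m n); rewrite ballEmdist /= => gm.
  rewrite (le_trans (metric_triangle _ (N b (maxn m n)).1 _))//.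
  by rewrite lerD// ?center ?leq_maxr// metric_sym ltW.
exists g => // b; apply/cvg_ballP => e e0.
have [n ne] : exists n, forall b, (N b n).2 < e / 2.
  by apply: small; rewrite divr_gt0.
apply: filterS (cantor_agree_nbhs b n) => c bc.
rewrite ballEmdist /= (le_lt_trans (metric_triangle _ (N b n).1 _))//.
rewrite [e]splitr ltrD//; first by rewrite metric_sym (le_lt_trans (gdisc b n)).
by rewrite (locN _ _ _ bc) (le_lt_trans (gdisc c n)).
Qed.

Lemma complete_separable_image_cantor (R : realType) (M : metricType R)
    (X : topologicalType) (f : M -> X) :
  hausdorff_space X -> complete_space M -> separable M -> continuous f ->
  ~ countable (range f) -> exists2 C : set X, cantor_set C & C `<=` range f.
Proof.
move=> hX cM sM cf ncf.
have [x0 cx0] : condensation_point f !=set0.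
  apply/set0P/eqP => G0; apply: ncf.
  by have := countable_image_noncondensation f sM; rewrite G0 setC0.
pose good (p : M * R) := condensation_point f p.1 /\ 0 < p.2.
(* [S] must be total for the recursion below; its value at a pair that is not good is arbitrary. *)
have /choice[S SP] (p : M * R) : exists q : bool -> M * R, good p ->
    (forall b, [/\ condensation_point f (q b).1, 0 < (q b).2,
                   (q b).2 <= p.2 / 2 & disc (q b) `<=` disc p]) /\
    (forall u v, disc (q true) u -> disc (q false) v -> f u <> f v).
  have [[gp rp]|ngp] := pselect (good p); last by exists (fun=> p).
  by have [q qP] := condensation_point_split hX sM cf gp rp; exists q.
(* The bit [b m] selects the child of the [m]-th node, so [N b n] depends only on the bits below
   [n]. *)
pose fix N (b : cantor_space) n : M * R :=
  if n is m.+1 then S (N b m) (b m) else (x0, 1).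
have gN b n : good (N b n).
  by elim: n => [|n /SP[+ _]]; [split|move=> /(_ (b n))[]].
have rN b n : 0 < (N b n).2 <= n.+1%:R^-1.
  rewrite (gN b n).2 /=; elim: n => [|n IH]; first by rewrite invr1.
  have [/(_ (b n))[_ _ + _] _] := SP _ (gN b n); move/le_trans; apply.
  (* Halving is enough, since twice [n.+1] is at least [n.+2]. *)
  apply: le_trans (_ : n.+1%:R^-1 / 2 <= _).
    by rewrite ler_pM2r ?invr_gt0.
  rewrite -invfM lef_pV2 ?posrE ?mulr_gt0// -natrM ler_nat.
  by rewrite muln2 doubleS !ltnS -addnn leq_addr.
have subN b n : disc (N b n.+1) `<=` disc (N b n).
  by have [/(_ (b n))[]] := SP _ (gN b n).
have locN (b c : cantor_space) n :
    (forall i, (i < n)%N -> b i = c i) -> N b n = N c n.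
  elim: n => //= n IH bc; rewrite bc// IH// => i ilt.
  by apply: bc; rewrite ltnS ltnW.
have [g cg gN'] := cantor_scheme_limit cM rN subN locN.
exists (range (f \o g)); last by move=> _ [b _ <-]; exists (g b).
apply: cantor_set_range => //.
  by move=> b; apply: continuous_comp; [exact: cg|exact: cf].
move=> b c /= fbc; apply: contrapT => bc.
have /existsNP ex : ~ forall i, b i = c i by move=> /funext.
have ex' : exists i, b i != c i by case: ex => i /eqP; exists i.
(* At the first differing bit the two branches leave a common node for different children, whose
   discs have disjoint images. *)
case: (ex_minnP ex') => n bcn minn.
have Ebc : N b n = N c n.
  apply: locN => i ilt; apply: contrapT => /eqP /minn.
  by rewrite leqNgt ilt.
have [_ sep] := SP _ (gN b n).
move: (gN' b n.+1) (gN' c n.+1) bcn; rewrite /= -Ebc.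
case: (b n) (c n) => -[] //= d1 d2 _; first exact: sep d1 d2 fbc.
exact: sep d2 d1 (esym fbc).
Qed.

(** * The perfect set property and invariant ideals *)

Lemma uncountable_analytic_cantor (R : realType) (X : topologicalType)
    (A : set X) :
  hausdorff_space X -> analytic R A -> ~ countable A ->
  exists2 C : set X, cantor_set C & C `<=` A.
Proof.
move=> hX [P [[D cD dD] [M cM [h [ch [g [cg hK gK]]]]]] [f cf ->]] ncA.
(* The Polish domain is replaced by its complete metric model [M], to which the dense set is carried
   by [h]. *)
have rE : range f = range (f \o g).
  apply/seteqP; split=> [_ [x _ <-]|_ [x _ <-]]; last by exists (g x).
  by exists (h x) => //=; rewrite hK.
rewrite rE; apply: complete_separable_image_cantor => //.
- exists (h @` D); first exact: sub_countable (card_image_le _ _) cD.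
  move=> O [x Ox] oO.
  have [||z [Oz Dz]] := dD (h @^-1` O).
  - by exists (g x); rewrite /= gK.
  - by apply: open_comp => // z _; exact: ch.
  - by exists (h z); split => //; exists z.
- by move=> x; apply: continuous_comp; [exact: cg|exact: cf].
- by rewrite -rE.
Qed.

Lemma invariant_ideal_minimal_cantor_sets (R : realType) (X : topologicalType)
    (I : set_system X) :
  hausdorff_space X -> ideal I -> (exists2 A, I A & ~ countable A) ->
  topologically_invariant I -> has_analytic_base R I ->
  minimal_cantor_sets X `<=` I.
Proof.
move=> hX [_ subI _] [A IA ncA] invI baseI K [_ minK].
have [B [IB anB AB]] := baseI _ IA.
have [|C canC CB] := uncountable_analytic_cantor hX anB.
  by apply: contra_not ncA; apply: sub_countable; exact: subset_card_le.
have [h homh hKC] := minK _ canC.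
have : I (h @` K) by apply: subI IB; exact: subset_trans CB.
(* Invariance presents the image of [K] as the image of some [K'] in [I]; applying the inverse of
   [h] gives [K = K']. *)
rewrite {1}(invI _ homh) => -[K' IK' hKK'].
suff -> : K = K' by [].
case: homh => _ [g [_ hK _]].
have imK (Z : set X) : g @` (h @` Z) = Z.
  by rewrite image_comp (eq_imagel (fun x _ => hK x)) image_id.
by rewrite -(imK K) -(imK K') hKK'.
Qed.

Theorem theorem1p2 (R : realType) :
  (forall I : set_system (hilbert_cube R),
     ideal I -> nontrivial_ideal I ->
     topologically_invariant I -> has_analytic_base R I ->
     minimal_cantor_sets (hilbert_cube R) `<=` I) /\
  (forall I : set_system (hilbert_cube R),
     sigma_ideal I -> nontrivial_ideal I ->
     topologically_invariant I -> has_analytic_base R I ->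
     sigma_generated (minimal_cantor_sets (hilbert_cube R)) `<=` I).
Proof.
have hH := @hilbert_cube_hausdorff R.
split=> [I iI [ncI _] invI baseI|I [iI sI] [ncI _] invI baseI].
  exact: invariant_ideal_minimal_cantor_sets hH iI ncI invI baseI.
move=> A [C [cC CF AC]]; have [_ subI _] := iI.
apply: subI AC _; apply: sI => //; apply: subset_trans CF _.
exact: invariant_ideal_minimal_cantor_sets hH iI ncI invI baseI.
Qed.
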